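(* Let $F\subseteq\mathbb{R}^n$, $f\colon\mathbb{R}^n\to\mathbb{R}$, let $(\mathcal{C},\mathcal{D},g,z,\mathcal{T},\epsilon)$ be an $(F,f)$-valid configuration, and let $x\in\bigcap\mathcal{C}$ with $g(x)=z'<z$. Then $(\mathcal{C},\mathcal{D},g,z',\mathcal{T},\epsilon)$ is also $(F,f)$-valid.
   Context: Constraints are arbitrary subsets of $\mathbb{R}^n$. For $\mathcal{C}\subseteq\mathcal{P}(\mathbb{R}^n)$ (power set) write $\bigcap\mathcal{C}=\bigcap_{C\in\mathcal{C}}C$, with $\bigcap\emptyset=\mathbb{R}^n$. For a list $\tau=(i_1,\dots,i_k)\in\{\pm1,\dots,\pm n\}^k$ write $\tau(x)=(\mathrm{sgn}(i_1)x_{|i_1|},\dots,\mathrm{sgn}(i_k)x_{|i_k|})\in\mathbb{R}^k$ for $x\in\mathbb{R}^n$ and $\tau(C)=\{\tau(x):x\in C\}$ for $C\subseteq\mathbb{R}^n$; the empty list is allowed. For another list $\tau'=(i'_1,\dots,i'_{k'})$, write $\tau\trianglelefteq\tau'$ if $k\le k'$ and $i_j=i'_j$ for all $1\le j\le k$. For a node $v$ of a directed graph, $\delta^+(v)$ is its set of children. Branching tree: a tuple $\mathcal{T}=(V,E,B,\sigma)$ is a $\mathcal{C}$-consistent branching tree if: (T1) $(V,E)$ is an arborescence with $1\le|V|<\infty$ and root $r\in V$. (T2) Each $v\in V$ has a branching constraint $B_v\subseteq\mathbb{R}^n$, and $B_r=\mathbb{R}^n$. (T3) For all $u\in V$ with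 $\delta^+(u)\ne\emptyset$: $\bigcap\mathcal{C}\subseteq\bigcup_{v\in\delta^+(u)}B_v$. (T4) Each $v\in V$ has a list $\sigma_v\in\{\pm1,\dots,\pm n\}^{\ell_v}$, $\ell_v\in\{0,\dots,n\}$, with $|(\sigma_v)_1|,\dots,|(\sigma_v)_{\ell_v}|$ pairwise distinct. (T5) $\sigma_u\trianglelefteq\sigma_v$ for all $u\in V$, $v\in\delta^+(u)$. (T6) For all $v\in V$ and $1\le i\le\ell_v$: $\max\{\sigma_v(x)_i:x\in\bigcap\mathcal{C}\}<\infty$ (i.e. the set is bounded above). (T7) For all $u\in V$ and $v\ne w$ in $\delta^+(u)$: $\sigma_u(B_v)\cap\sigma_u(B_w)=\emptyset$. Relations: for $v\in V$ let $\mathcal{B}_v=\{B_u: u \text{ is a node on the } r\text{-}v\text{-path in } \mathcal{T}\}$. For $x,y\in\bigcap\mathcal{C}$ let $\mathrm{dcn}(x,y)$ be the deepest node $w\in V$ with $x,y\in\bigcap(\mathcal{C}\cup\mathcal{B}_w)$. For $\epsilon>0$ and $a,b\in\mathbb{R}^k$, let $a\succ_\epsilon b$ mean $a\neq b$ and $a_i\ge b_i+\epsilon$ for the smallest index $i$ with $a_i\ne b_i$. For $x,y\in\bigcap\mathcal{C}$ and $v=\mathrm{dcn}(x,y)$: $x\succeq_{\epsilon,\mathcal{T}}y$ iff $\sigma_v(x)=\sigma_v(y)$ or $\sigma_v(x)\succ_\epsilon\sigma_v(y)$; $x\succ_{\epsilon,\mathcal{T}}y$ iff $\sigma_v(x)\succ_\epsilon\sigma_v(y)$.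 Configuration: let $F\subseteq\mathbb{R}^n$, $f\colon\mathbb{R}^n\to\mathbb{R}$. A configuration $(\mathcal{C},\mathcal{D},g,z,\mathcal{T},\epsilon)$ with $\mathcal{C},\mathcal{D}\subseteq\mathcal{P}(\mathbb{R}^n)$, $g\colon\mathbb{R}^n\to\mathbb{R}$, $z\in\mathbb{R}\cup\{\infty\}$, $\mathcal{T}$ a branching tree and $\epsilon$ a real number is $(F,f)$-valid if: (V1) $\mathcal{T}$ is $\mathcal{C}$-consistent and $\epsilon>0$. (V2) If $z<\infty$, there exists $x\in F$ with $f(x)\le z$. (V3) For all real $\hat z<z$, there exists $x\in F$ with $f(x)\le\hat z$ if and only if there exists $x\in\bigcap\mathcal{C}$ with $g(x)\le\hat z$. (V4) For every $x\in\bigcap\mathcal{C}$ with $g(x)<z$ there exists $y\in\bigcap(\mathcal{C}\cup\mathcal{D})$ with $y\succeq_{\epsilon,\mathcal{T}}x$ and $g(y)\le g(x)$. *)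

(* Defs.v *)
From HB Require Import structures.
From mathcomp Require Import all_boot all_order all_algebra.
From mathcomp Require Import all_classical all_reals.

Set Implicit Arguments.
Unset Strict Implicit.
Unset Printing Implicit Defensive.

Import Order.TTheory GRing.Theory Num.Theory.

Local Open Scope classical_set_scope.
Local Open Scope ring_scope.

(* The intersection of a family of constraints; it is setT for the empty
   family. *)
Definition meet_of (T : Type) (C : set (set T)) : set T := \bigcap_(A in C) A.

(* A nonzero index in {-n, ..., -1, 1, ..., n}: (s, i) stands for the index of
   absolute value i + 1, negative iff s = true. *)
Definition sindex (n : nat) : eqType := (bool * 'I_n)%type.

Definition sact (R : realType) (n : nat) (tau : seq (sindex n)) (x : 'rV[R]_n) :
    'rV[R]_(size tau) :=
  \row_(j < size tau) ((-1) ^+ (tnth (in_tuple tau) j).1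
                       * x ord0 (tnth (in_tuple tau) j).2).

Definition lex_gt (R : realType) (k : nat) (eps : R) (a b : 'rV[R]_k) : Prop :=
  exists i : 'I_k,
    [/\ forall j : 'I_k, (j < i)%N -> a ord0 j = b ord0 j,
        a ord0 i <> b ord0 i
      & b ord0 i + eps <= a ord0 i].

(* Every vertex is reached by exactly one directed walk from r; p lists the
   vertices of the walk after r. For v = r this excludes cycles through r. *)
Definition arborescence (V : finType) (e : rel V) (r : V) : Prop :=
  forall v : V, exists! p : seq V, path e r p /\ last r p = v.

Record branching_tree (R : realType) (n : nat) := BranchingTree {
  node : finType;
  edge : rel node;
  root : node;
  bconstr : node -> set 'rV[R]_n;
  sigma : node -> seq (sindex n)
}.

Section Tree.
Variables (R : realType) (n : nat) (T : branching_tree R n).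
Implicit Types (C : set (set 'rV[R]_n)) (x y : 'rV[R]_n) (u v w : node T).

Definition children u : set (node T) := [set v | edge u v].

Record consistent C : Prop := Consistent {
  arb_tree : arborescence (@edge _ _ T) (root T);
  bconstr_root : bconstr (root T) = setT;
  bconstr_cover : forall u, children u !=set0 ->
    meet_of C `<=` \bigcup_(v in children u) bconstr v;
  sigma_wf : forall v,
    (size (sigma v) <= n)%N /\ uniq [seq s.2 | s <- sigma v];
  sigma_prefix : forall u v, children u v -> prefix (sigma u) (sigma v);
  sigma_bounded : forall v (i : 'I_(size (sigma v))),
    has_ubound [set sact (sigma v) x ord0 i | x in meet_of C];
  bconstr_disjoint : forall u v w, children u v -> children u w -> v <> w ->
    (sact (sigma u) @` bconstr v) `&` (sact (sigma u) @` bconstr w) = set0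
}.

(* The walk from the root to v, without its first vertex root T; it is
   well defined as soon as the tree is an arborescence. *)
Definition root_path v : seq (node T) :=
  xget [::] [set p | path (@edge _ _ T) (root T) p /\ last (root T) p = v].

Definition depth v : nat := size (root_path v).

Definition path_constrs v : set (set 'rV[R]_n) :=
  [set bconstr u | u in [set u | u \in root T :: root_path v]].

Definition both_at C x y w : Prop :=
  meet_of (C `|` path_constrs w) x /\ meet_of (C `|` path_constrs w) y.

(* The deepest node w such that both_at C x y w. When T is C-consistent and x
   and y lie in meet_of C, the root is such a node, and the deepest one is
   unique: see dcnP and dcn_uniq. *)
Definition dcn C x y : node T :=
  [arg max_(w > root T | `[< both_at C x y w >]) depth w]%N.

Definition tree_gt C (eps : R) x y : Prop :=
  let v := dcn C x y in lex_gt eps (sact (sigma v) x) (sact (sigma v) y).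

Definition tree_ge C (eps : R) x y : Prop :=
  let v := dcn C x y in
  sact (sigma v) x = sact (sigma v) y \/ tree_gt C eps x y.

Lemma root_pathP v : arborescence (@edge _ _ T) (root T) ->
  path (@edge _ _ T) (root T) (root_path v) /\
  last (root T) (root_path v) = v.
Proof.
move=> /(_ v) [p [pP _]]; rewrite /root_path.
by case: xgetP => [q _ //|/(_ p)]; case.
Qed.

Lemma dcnP C x y : consistent C -> meet_of C x -> meet_of C y ->
  both_at C x y (dcn C x y) /\
  forall w, both_at C x y w -> (depth w <= depth (dcn C x y))%N.
Proof.
move=> cT Cx Cy.
have rootxy : both_at C x y (root T).
  have rp : root_path (root T) = [::].
    have [p [_ pU]] := arb_tree cT (root T).
    by rewrite -(pU _ (root_pathP _ (arb_tree cT))) (pU [::]).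
  by split=> A [CA|[u /=]]; [exact: Cx| |exact: Cy|];
    rewrite rp inE => /eqP -> <-; rewrite (bconstr_root cT).
rewrite /dcn; case: arg_maxnP => [|w /asboolP wP wmax]; first exact/asboolP.
by split=> // w' /asboolP; exact: wmax.
Qed.

Lemma dcn_uniq C x y w : consistent C -> meet_of C x -> meet_of C y ->
  both_at C x y w -> depth w = depth (dcn C x y) -> w = dcn C x y.
Proof.
move=> cT Cx Cy wP; have [] := dcnP cT Cx Cy; move: (dcn C x y) => w' w'P _.
have in_path v u : both_at C x y v -> u \in root_path v ->
    bconstr u x /\ bconstr u y.
  move=> [vx vy] uv; split; [apply: vx|apply: vy]; right; exists u => //=;
  by rewrite inE uv orbT.
have [p1 l1] := root_pathP w (arb_tree cT).
have [p2 l2] := root_pathP w' (arb_tree cT).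
suff e : size (root_path w) = size (root_path w') -> root_path w = root_path w'.
  by move=> /e pE; rewrite -l1 -l2 pE.
move: (in_path w ^~ wP) (in_path w' ^~ w'P) p1 p2 => {l1 l2 in_path}.
elim: (root_path w) (root_path w') (root T) => [|a p IH] [|b q] //= u.
move=> pB qB /andP[ua pa] /andP[ub qb] [eqs].
have [ax _] := pB a (mem_head _ _); have [bx _] := qB b (mem_head _ _).
have eab : a = b.
  apply: contrapT => ab.
  have : set0 (sact (sigma u) x).
    by rewrite -(bconstr_disjoint cT ua ub ab); split; exists x.
  by [].
rewrite -eab in qb *; congr cons; apply: IH qb eqs => // c cp.
- by apply: pB; rewrite inE cp orbT.
- by apply: qB; rewrite inE cp orbT.
Qed.

End Tree.

(* The bound z ranges over the reals and +oo, hence the condition that it is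
   not -oo. *)
Record valid (R : realType) (n : nat) (F : set 'rV[R]_n) (f : 'rV[R]_n -> R)
    (C D : set (set 'rV[R]_n)) (g : 'rV[R]_n -> R) (z : \bar R)
    (T : branching_tree R n) (eps : R) : Prop := Valid {
  valid_bound : z <> -oo%E;
  valid_tree : consistent T C /\ 0 < eps;
  valid_attained : (z < +oo)%E -> exists2 x, F x & ((f x)%:E <= z)%E;
  valid_below : forall zh : R, (zh%:E < z)%E ->
    (exists2 x, F x & f x <= zh) <-> (exists2 x, meet_of C x & g x <= zh);
  valid_dom : forall x, meet_of C x -> ((g x)%:E < z)%E ->
    exists y, [/\ meet_of (C `|` D) y, tree_ge T C eps y x & g y <= g x]
}.

(* Main.v *)
Require Import Defs.
From mathcomp Require Import all_boot all_order all_algebra.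
From mathcomp Require Import all_classical all_reals.

(** Lowering the bound from z to z' restricts the conditions on the values
    below the bound to fewer values, so these conditions are inherited. The
    one new obligation is that the bound z' be attained, that is, that some
    point of F have f-value at most z'. The point x satisfies g x <= z' in the
    intersection of C, and the equivalence between the two problems holds at
    the value z' itself because z' < z is strict. *)
Theorem theorem4 (R : realType) (n : nat) (F : set 'rV[R]_n)
    (f : 'rV[R]_n -> R) (C D : set (set 'rV[R]_n)) (g : 'rV[R]_n -> R)
    (z : \bar R) (T : branching_tree R n) (eps : R)
    (x : 'rV[R]_n) (z' : R) :
  valid F f C D g z T eps ->
  meet_of C x -> g x = z' -> (z'%:E < z)%E ->
  valid F f C D g z'%:E T eps.
Proof.
move=> [_ tree_ok _ below dom] Cx gx z'z; split=> //.
- move=> _; have [y Fy fy] : exists2 y, F y & (f y <= z')%R.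
    by apply/(below z' z'z); exists x => //; rewrite gx.
  by exists y; rewrite ?lee_fin.
- by move=> zh zh_lt; apply: below; exact: Order.POrderTheory.lt_trans z'z.
- by move=> y Cy gy; apply: dom => //; exact: Order.POrderTheory.lt_trans z'z.
Qed.
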